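(* Let $X$ be an $N\times M$ matrix and let $K_r\in\{1,\dots,N\}$, $K_c\in\{1,\dots,M\}$. Let ${\cal R}$ be a partition of the rows $[N]$ into $K_r$ clusters minimizing $L_R=\sum_{R\in{\cal R}}\sum_{j=1}^M{\cal V}(X(R,j))$, and let ${\cal C}$ be a partition of the columns $[M]$ into $K_c$ clusters minimizing $L_C=\sum_{i=1}^N\sum_{C\in{\cal C}}{\cal V}(X(i,C))$ (i.e. ${\cal R}$ and ${\cal C}$ are optimal one-way clusterings of rows and of columns, computed independently). Let $L=\sum_{R\in{\cal R}}\sum_{C\in{\cal C}}{\cal V}(X(R,C))$, and let $L^*$ be the minimum of $\sum_{R^*\in{\cal R}^*}\sum_{C^*\in{\cal C}^*}{\cal V}(X(R^*,C^* ))$ over all pairs consisting of a partition ${\cal R}^*$ of $[N]$ into $K_r$ clusters and a partition ${\cal C}^*$ of $[M]$ into $K_c$ clusters (the optimal biclustering cost). Then $L\le \alpha L^*$, where: (a) $\alpha=1+\sqrt2$ if $X\in\{0,1\}^{N\times M}$ and ${\cal V}$ is the $L_1$ dissimilarity; (b) $\alpha=2$ if $X\in\mathbb{R}^{N\times M}$ and ${\cal V}$ is the $L_2$ dissimilarity.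
   Context: For $T\in\mathbb{N}$, $[T]=\{1,\dots,T\}$. For $R\subseteq[N]$ and $C\subseteq[M]$, $X(R,C)$ denotes the submatrix of $X$ with rows $R$ and columns $C$; $X(R,j)$ and $X(i,C)$ denote $X(R,\{j\})$ and $X(\{i\},C)$. For a matrix $Y$, the $L_1$ dissimilarity is ${\cal V}(Y)=\sum_{y\in Y}|y-\mathrm{median}(Y)|$ and the $L_2$ dissimilarity is ${\cal V}(Y)=\sum_{y\in Y}(y-\mathrm{mean}(Y))^2$, where the sum ranges over all entries of $Y$ (with multiplicity) and the median/mean is taken over all entries of $Y$. *)

(* Defs.v *)
From mathcomp Require Import all_boot all_order all_algebra.
From mathcomp Require Import reals.

Set Implicit Arguments.
Unset Strict Implicit.
Unset Printing Implicit Defensive.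

Import Order.TTheory GRing.Theory Num.Theory.
Local Open Scope ring_scope.

Section Dissimilarity.
Variable R : realType.

Definition submatrix (N M : nat) (X : 'M[R]_(N, M))
    (A : {set 'I_N}) (B : {set 'I_M}) : 'M[R]_(#|A|, #|B|) :=
  mxsub (@enum_val _ (mem A)) (@enum_val _ (mem B)) X.

Definition entries (m n : nat) (Y : 'M[R]_(m, n)) : seq R :=
  [seq Y i j | i <- enum 'I_m, j <- enum 'I_n].

(* The two indices coincide when the number of entries is odd; otherwise this
   is the midpoint of the two central entries. *)
Definition median (m n : nat) (Y : 'M[R]_(m, n)) : R :=
  let s := sort <=%R (entries Y) in
  (s`_((size s).-1)./2 + s`_((size s)./2)) / 2.

Definition mean (m n : nat) (Y : 'M[R]_(m, n)) : R :=
  (\sum_i \sum_j Y i j) / (m * n)%:R.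

Definition dissim_L1 (m n : nat) (Y : 'M[R]_(m, n)) : R :=
  \sum_i \sum_j `|Y i j - median Y|.

Definition dissim_L2 (m n : nat) (Y : 'M[R]_(m, n)) : R :=
  \sum_i \sum_j (Y i j - mean Y) ^+ 2.

End Dissimilarity.

(* Clusters are nonempty: [partition] excludes [set0] as a block. *)
Definition clustering (n K : nat) (P : {set {set 'I_n}}) : Prop :=
  partition P [set: 'I_n] /\ #|P| = K.

Section Costs.
Variables (R : realType) (V : forall m n : nat, 'M[R]_(m, n) -> R).
Variables (N M : nat) (X : 'M[R]_(N, M)).

Definition row_cost (P : {set {set 'I_N}}) : R :=
  \sum_(A in P) \sum_(j < M) V (submatrix X A [set j]).

Definition col_cost (Q : {set {set 'I_M}}) : R :=
  \sum_(i < N) \sum_(B in Q) V (submatrix X [set i] B).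

Definition bicluster_cost (P : {set {set 'I_N}}) (Q : {set {set 'I_M}}) : R :=
  \sum_(A in P) \sum_(B in Q) V (submatrix X A B).

Definition optimal_rows (Kr : nat) (P : {set {set 'I_N}}) : Prop :=
  clustering Kr P /\
  forall P' : {set {set 'I_N}}, clustering Kr P' -> row_cost P <= row_cost P'.

Definition optimal_cols (Kc : nat) (Q : {set {set 'I_M}}) : Prop :=
  clustering Kc Q /\
  forall Q' : {set {set 'I_M}}, clustering Kc Q' -> col_cost Q <= col_cost Q'.

Definition is_optimal_bicluster_cost (Kr Kc : nat) (Lstar : R) : Prop :=
  (exists P Q, [/\ clustering Kr P, clustering Kc Q &
                   bicluster_cost P Q = Lstar]) /\
  (forall P Q, clustering Kr P -> clustering Kc Q ->
     Lstar <= bicluster_cost P Q).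

End Costs.

(* Main.v *)
(* Both dissimilarities are minima over [c] of a sum of pointwise losses
   [f (Y i j) c].  Hence cutting the blocks of an optimal biclustering into
   columns, or into rows, does not increase the cost, so [L_R <= L*] and
   [L_C <= L*].  It remains to bound, for a single block, the dissimilarity of
   the block by [k] times the sum of its columnwise and rowwise dissimilarities;
   the ratio is then [2 * k].  For L2, [k = 1] follows from the decomposition of
   the variance and Jensen's inequality.  For binary L1, [k = (1 + sqrt 2) / 2]:
   rounding each row and each column to its majority value splits the block
   into four rectangles, and the two one-way costs together charge every cell
   on which the row and column majorities disagree exactly once.  The extremal
   case is a square of ones of relative side [1 / sqrt 2] in a block of zeros. *)
Require Import Defs.
From mathcomp Require Import all_boot all_order all_algebra.
From mathcomp Require Import reals.
From mathcomp Require Import zify ring lra.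

Set Implicit Arguments.
Unset Strict Implicit.
Unset Printing Implicit Defensive.

Import Order.TTheory GRing.Theory Num.Theory.
Local Open Scope ring_scope.

(** The minimum is stated as an attained lower bound, uniformly in the shape, so that the optimal
    [c] of a block can be tested on its rows and columns. *)
Definition minimal_loss (R : realType) (f : R -> R -> R)
    (V : forall m n : nat, 'M[R]_(m, n) -> R) : Prop :=
  forall (m n : nat) (Y : 'M[R]_(m, n)),
    (exists c, V m n Y = \sum_i \sum_j f (Y i j) c) /\
    (forall c, V m n Y <= \sum_i \sum_j f (Y i j) c).

(** * Reduction to a bound on single blocks *)

Section OneWayBound.
Variables (R : realType) (f : R -> R -> R).
Variable V : forall m n : nat, 'M[R]_(m, n) -> R.
Hypothesis V_loss : minimal_loss f V.
Variables (N M : nat) (X : 'M[R]_(N, M)).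

Lemma sum_submatrix (A : {set 'I_N}) (B : {set 'I_M}) (g : R -> R) :
  \sum_i \sum_j g (submatrix X A B i j) = \sum_(i in A) \sum_(j in B) g (X i j).
Proof.
rewrite [RHS]big_enum_val; apply: eq_bigr => i _.
by rewrite [RHS]big_enum_val; apply: eq_bigr => j _; rewrite mxE.
Qed.

Lemma submatrix_attained (A : {set 'I_N}) (B : {set 'I_M}) :
  exists c, V (submatrix X A B) = \sum_(i in A) \sum_(j in B) f (X i j) c.
Proof.
have [[c ->] _] := V_loss (submatrix X A B).
by exists c; rewrite (sum_submatrix A B (f^~ c)).
Qed.

Lemma submatrix_le (A : {set 'I_N}) (B : {set 'I_M}) (c : R) :
  V (submatrix X A B) <= \sum_(i in A) \sum_(j in B) f (X i j) c.
Proof.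
have [_ /(_ c)] := V_loss (submatrix X A B).
by rewrite (sum_submatrix A B (f^~ c)).
Qed.

Lemma cut_columns_le (A : {set 'I_N}) (B : {set 'I_M}) :
  \sum_(j in B) V (submatrix X A [set j]) <= V (submatrix X A B).
Proof.
have [c ->] := submatrix_attained A B.
rewrite exchange_big /=; apply: ler_sum => j _.
apply: le_trans (submatrix_le A [set j] c) _.
by under [leLHS]eq_bigr do rewrite big_set1.
Qed.

Lemma cut_rows_le (A : {set 'I_N}) (B : {set 'I_M}) :
  \sum_(i in A) V (submatrix X [set i] B) <= V (submatrix X A B).
Proof.
have [c ->] := submatrix_attained A B.
apply: ler_sum => i _.
apply: le_trans (submatrix_le [set i] B c) _.
by rewrite big_set1.
Qed.

Lemma sum_clustering (n K : nat) (P : {set {set 'I_n}}) (F : 'I_n -> R) :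
  clustering K P -> \sum_(i < n) F i = \sum_(A in P) \sum_(i in A) F i.
Proof.
case=> partP _; rewrite -(set_partition_big _ partP) /=.
by apply: eq_bigl => i; rewrite inE.
Qed.

Lemma row_cost_blocks (K : nat) (P : {set {set 'I_N}}) (Q : {set {set 'I_M}}) :
  clustering K Q ->
  row_cost V X P =
    \sum_(A in P) \sum_(B in Q) \sum_(j in B) V (submatrix X A [set j]).
Proof. by move=> cQ; apply: eq_bigr => A _; exact: sum_clustering cQ. Qed.

Lemma col_cost_blocks (K : nat) (P : {set {set 'I_N}}) (Q : {set {set 'I_M}}) :
  clustering K P ->
  col_cost V X Q =
    \sum_(A in P) \sum_(B in Q) \sum_(i in A) V (submatrix X [set i] B).
Proof.
move=> cP; rewrite /col_cost (sum_clustering _ cP).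
by apply: eq_bigr => A _; rewrite exchange_big.
Qed.

Lemma bicluster_ratio (k Lstar : R) (Kr Kc : nat)
    (P : {set {set 'I_N}}) (Q : {set {set 'I_M}}) :
  0 <= k ->
  (forall A B, V (submatrix X A B) <=
     k * (\sum_(j in B) V (submatrix X A [set j]) +
          \sum_(i in A) V (submatrix X [set i] B))) ->
  optimal_rows V X Kr P -> optimal_cols V X Kc Q ->
  is_optimal_bicluster_cost V X Kr Kc Lstar ->
  bicluster_cost V X P Q <= 2 * k * Lstar.
Proof.
move=> k0 Vk [cP minP] [cQ minQ] [[P' [Q' [cP' cQ' <-]]] _].
(* [P'] and [Q'] attain the optimum; [P'] alone competes with [P], and [Q'] alone with [Q]. *)
have rowsL : row_cost V X P <= bicluster_cost V X P' Q'.
  apply: le_trans (minP _ cP') _; rewrite (row_cost_blocks _ cQ').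
  by apply: ler_sum => A _; apply: ler_sum => B _; exact: cut_columns_le.
have colsL : col_cost V X Q <= bicluster_cost V X P' Q'.
  apply: le_trans (minQ _ cQ') _; rewrite (col_cost_blocks _ cP').
  by apply: ler_sum => A _; apply: ler_sum => B _; exact: cut_rows_le.
have : bicluster_cost V X P Q <= k * (row_cost V X P + col_cost V X Q).
  rewrite (row_cost_blocks _ cQ) (col_cost_blocks _ cP) -big_split mulr_sumr.
  apply: ler_sum => A _; rewrite -big_split mulr_sumr.
  by apply: ler_sum => B _; exact: Vk.
nra.
Qed.

End OneWayBound.

(** * Least squares *)

Section LeastSquares.
Variable R : realType.

(** The parallel-axis identity: deviations from the mean [a] sum to zero, so there is no cross
    term. *)
Lemma sum_sqr_split (I : finType) (A : {pred I}) (y : I -> R) (c : R) :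
  (0 < #|A|)%N ->
  let a := (\sum_(i in A) y i) / #|A|%:R in
  \sum_(i in A) (y i - c) ^+ 2 =
    \sum_(i in A) (y i - a) ^+ 2 + #|A|%:R * (a - c) ^+ 2.
Proof.
move=> A0 a.
have n0 : #|A|%:R != 0 :> R by rewrite pnatr_eq0 -lt0n.
have sum_y : \sum_(i in A) y i = #|A|%:R * a by rewrite /a mulrC divfK.
have expand d : \sum_(i in A) (y i - d) ^+ 2 =
    \sum_(i in A) y i ^+ 2 - 2 * d * (#|A|%:R * a) + #|A|%:R * d ^+ 2.
  have sqrB i : (y i - d) ^+ 2 = y i ^+ 2 - 2 * d * y i + d ^+ 2 by ring.
  under eq_bigr do rewrite sqrB.
  by rewrite big_split sumrB -mulr_sumr sum_y sumr_const (mulr_natl (d ^+ 2)).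
rewrite !expand; ring.
Qed.

(** Jensen's inequality for the square, from the split at [c = 0]. *)
Lemma sum_sqr_ge_mean (I : finType) (A : {pred I}) (y : I -> R) :
  (0 < #|A|)%N ->
  #|A|%:R * ((\sum_(i in A) y i) / #|A|%:R) ^+ 2 <= \sum_(i in A) y i ^+ 2.
Proof.
move=> A0; under [leRHS]eq_bigr => i _ do rewrite -[y i]subr0.
rewrite (sum_sqr_split _ _ A0) subr0 lerDr.
by apply: sumr_ge0 => i _; exact: sqr_ge0.
Qed.

Lemma minimal_loss_L2 :
  minimal_loss (fun y c : R => (y - c) ^+ 2) (@dissim_L2 R).
Proof.
move=> m n Y; split; first by exists (mean Y).
move=> c; rewrite /dissim_L2 /mean !pair_bigA /=.
have cardE : #|{: 'I_m * 'I_n}| = (m * n)%N by rewrite card_prod !card_ord.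
(* For an empty matrix [mean] divides by zero, but both sums are empty. *)
have [mn0|mn0] := posnP (m * n).
  have empty : {: 'I_m * 'I_n} =i pred0 by apply: card0_eq; rewrite cardE.
  by rewrite !big1 // => p; have := empty p.
have := @sum_sqr_split _ {: 'I_m * 'I_n} (fun p => Y p.1 p.2) c.
rewrite cardE => /(_ mn0) ->.
by rewrite lerDl mulr_ge0 ?ler0n ?sqr_ge0.
Qed.

(** The test constant is the mean [mu] of the optimal row constants [b i]. In column [j], the column
    mean minus [mu] is the mean over [i] of [X i j - b i], so Jensen bounds the offset term by the
    share of column [j] in the row costs. *)
Lemma L2_block_le (N M : nat) (X : 'M[R]_(N, M))
    (A : {set 'I_N}) (B : {set 'I_M}) :
  dissim_L2 (submatrix X A B) <=
    \sum_(j in B) dissim_L2 (submatrix X A [set j]) +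
    \sum_(i in A) dissim_L2 (submatrix X [set i] B).
Proof.
have [A0|A0] := posnP #|A|.
  apply: le_trans (submatrix_le minimal_loss_L2 X A B 0) _.
  rewrite (cards0_eq A0) big_set0 big_set0 addr0.
  apply: sumr_ge0 => j _; apply: sumr_ge0 => i _; apply: sumr_ge0 => k _.
  exact: sqr_ge0.
have [b bE] : exists b, forall i, dissim_L2 (submatrix X [set i] B) =
    \sum_(j in B) (X i j - b i) ^+ 2.
  (* Stated with [==] because [xchoose] needs a boolean predicate. *)
  have ex i : exists c, dissim_L2 (submatrix X [set i] B) ==
      \sum_(j in B) (X i j - c) ^+ 2.
    have [c ->] := submatrix_attained minimal_loss_L2 X [set i] B.
    by exists c; rewrite big_set1.
  by exists (fun i => xchoose (ex i)) => i; exact/eqP/(xchooseP (ex i)).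
pose mu := (\sum_(i in A) b i) / #|A|%:R.
apply: le_trans (submatrix_le minimal_loss_L2 X A B mu) _.
under [X in _ + X]eq_bigr do rewrite bE.
rewrite exchange_big [X in _ + X]exchange_big -big_split /=.
apply: ler_sum => j _.
have [c ->] := submatrix_attained minimal_loss_L2 X A [set j].
under [X in X + _]eq_bigr do rewrite big_set1.
(* Both sides are recentred at the column mean; the surplus at [c] is nonnegative. *)
rewrite (sum_sqr_split _ mu A0) (sum_sqr_split _ c A0).
have := sum_sqr_ge_mean (fun i => X i j - b i) A0.
rewrite sumrB mulrBl => jensen; apply: lerD jensen.
by rewrite lerDl mulr_ge0 ?ler0n ?sqr_ge0.
Qed.

End LeastSquares.

(** * Least absolute deviations and binary matrices *)

Section LeastAbsolute.
Variable R : realType.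

(* Pair the [k]-th smallest entry with the [k]-th largest one: the median lies
   between them, so it minimizes the sum of the distances to both. *)
Lemma sorted_median_le (s : seq R) (d : R) : sorted <=%R s ->
  let c := (s`_((size s).-1)./2 + s`_((size s)./2)) / 2 in
  \sum_(y <- s) `|y - c| <= \sum_(y <- s) `|y - d|.
Proof.
move=> sorted_s /=; set c := _ / 2.
have nondecr i j : (i <= j < size s)%N -> s`_i <= s`_j.
  case/andP=> ij js; apply: (sorted_leq_nth le_trans lexx) => //.
  by rewrite inE (leq_ltn_trans ij js).
(* Adding the sum to its own reversal treats even and odd sizes alike; a middle entry is paired with
   itself. *)
have double e : 2 * \sum_(y <- s) `|y - e| =
    \sum_(0 <= k < size s) (`|s`_k - e| + `|s`_(size s - k.+1) - e|).
  rewrite big_split /= (big_nth 0) mulr_natl mulr2n; congr (_ + _).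
  by rewrite big_nat_rev.
have pairing i j : (i + j).+1 = size s -> (i <= j)%N ->
    `|s`_i - c| + `|s`_j - c| <= `|s`_i - d| + `|s`_j - d|.
  move=> ijs ij.
  have i1 : s`_i <= s`_((size s).-1)./2 by apply: nondecr; lia.
  have i2 : s`_i <= s`_((size s)./2) by apply: nondecr; lia.
  have j1 : s`_((size s).-1)./2 <= s`_j by apply: nondecr; lia.
  have j2 : s`_((size s)./2) <= s`_j by apply: nondecr; lia.
  have ic : s`_i <= c by rewrite /c; lra.
  have jc : c <= s`_j by rewrite /c; lra.
  (* At [c] the pair costs exactly the gap between its entries, a lower bound at any [d]. *)
  rewrite ler0_norm ?subr_le0 // ger0_norm ?subr_ge0 //.
  by have := ler_norm (d - s`_i); have := ler_norm (s`_j - d); rewrite (distrC d); lra.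
rewrite -(ler_pM2l (ltr0n R 2)) !double.
apply: ler_sum_nat => k /andP[_ ks].
case: (leqP k (size s - k.+1)) => [|/ltnW] kk; first by apply: pairing; lia.
by rewrite addrC [leRHS]addrC; apply: pairing => //; lia.
Qed.

Lemma minimal_loss_L1 :
  minimal_loss (fun y c : R => `|y - c|) (@dissim_L1 R).
Proof.
move=> m n Y; split; first by exists (median Y).
have entriesE g : \sum_i \sum_j g (Y i j) =
    \sum_(y <- sort <=%R (entries Y)) g y :> R.
  rewrite (perm_big (entries Y)) ?perm_sort // /entries big_allpairs_dep /=.
  by rewrite big_enum; apply: eq_bigr => i _; rewrite big_enum.
move=> c; rewrite /dissim_L1.
rewrite (entriesE (fun y => `|y - median Y|)) (entriesE (fun y => `|y - c|)).
by apply: sorted_median_le; apply: sort_sorted => x y; exact: le_total.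
Qed.

(** For 0/1 values the two sums count the zeros and the ones; ties go to 1. *)
Definition majority (I : finType) (A : {pred I}) (x : I -> R) : bool :=
  \sum_(i in A) `|x i - 1| <= \sum_(i in A) `|x i|.

(** On 0/1 data the loss is affine in [c] on the unit interval, and outside it no smaller than at
    the nearer endpoint, so an endpoint is optimal. *)
Lemma majority_le (I : finType) (A : {pred I}) (x : I -> R) (c : R) :
  (forall i, x i = 0 \/ x i = 1) ->
  \sum_(i in A) `|x i - (majority A x)%:R| <= \sum_(i in A) `|x i - c|.
Proof.
move=> bin_x.
suff : \sum_(i in A) `|x i - 1| <= \sum_(i in A) `|x i - c| \/
       \sum_(i in A) `|x i| <= \sum_(i in A) `|x i - c|.
  case: (boolP (majority A x)) => maj /=.
    by case=> [|le0] //; exact: le_trans maj le0.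
  under [X in _ -> X <= _]eq_bigr do rewrite subr0.
  case=> // le1; apply: le_trans le1; apply: ltW.
  by move: maj; rewrite -ltNge.
have [c0|c0] := leP c 0.
  right; apply: ler_sum => i _; case: (bin_x i) => ->.
    by rewrite normr0.
  by rewrite normr1 ger0_norm; lra.
have [c1|c1] := leP 1 c.
  left; apply: ler_sum => i _; case: (bin_x i) => ->.
    by rewrite !sub0r !normrN normr1 ger0_norm; lra.
  by rewrite subrr normr0.
have : \sum_(i in A) `|x i - c| =
    c * \sum_(i in A) `|x i - 1| + (1 - c) * \sum_(i in A) `|x i|.
  rewrite !mulr_sumr -big_split; apply: eq_bigr => i _ /=.
  case: (bin_x i) => ->.
    by rewrite !sub0r !normrN normr1 normr0 ger0_norm; lra.
  by rewrite subrr normr0 normr1 ger0_norm; lra.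
move=> ->; case: (leP (\sum_(i in A) `|x i - 1|) (\sum_(i in A) `|x i|)) => h.
  by left; nra.
by right; nra.
Qed.

(* [s], [t] and [n] are the square roots of the areas of two diagonally opposite
   rectangles and of the whole block. *)
Lemma diagonal_rectangles_sqrt (s t n : R) :
  0 <= s -> 0 <= t -> s + t <= n ->
  [\/ n ^+ 2 - t ^+ 2 <=
        (1 + Num.sqrt 2) / 2 * (n ^+ 2 - s ^+ 2 - t ^+ 2),
      n ^+ 2 - s ^+ 2 <=
        (1 + Num.sqrt 2) / 2 * (n ^+ 2 - s ^+ 2 - t ^+ 2) |
      n ^+ 2 / 2 <=
        (1 + Num.sqrt 2) / 2 * (n ^+ 2 - s ^+ 2 - t ^+ 2)].
Proof.
set r := Num.sqrt 2.
have r2 : r * r = 2 by rewrite -expr2 sqr_sqrtr.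
have r0 : 0 <= r := sqrtr_ge0 2.
have r1 : 1 < r by nra.
have r32 : r <= 3 / 2 by nra.
(* As [a <= n - b], the last bracket is at least [2 * b * (n - b)]; cancelling [n - b] leaves
   [n <= r * b]. *)
have large (a b : R) : 0 <= a -> 0 <= b -> a + b <= n -> n <= r * b ->
    n ^+ 2 - b ^+ 2 <= (1 + r) / 2 * (n ^+ 2 - a ^+ 2 - b ^+ 2).
  move=> a0 b0 abn nb.
  have a2 : a ^+ 2 <= (n - b) ^+ 2 by rewrite lerXn2r ?nnegrE; lra.
  have area : 2 * b * (n - b) <= n ^+ 2 - a ^+ 2 - b ^+ 2 by lra.
  apply: le_trans (_ : (1 + r) / 2 * (2 * b * (n - b)) <= _); last first.
    by apply: ler_wpM2l => //; lra.
  have : 0 <= (r * b - n) * (n - b) by apply: mulr_ge0; lra.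
  lra.
have small (a b : R) : 0 <= b -> b <= a -> a + b <= n -> r * a <= n ->
    n ^+ 2 / 2 <= (1 + r) / 2 * (n ^+ 2 - a ^+ 2 - b ^+ 2).
  move=> b0 ba abn an.
  (* Here [2 - r = 1 - (r - 1)], and [r - 1] is the inverse of [1 + r]. *)
  suff : a ^+ 2 + b ^+ 2 <= (2 - r) * n ^+ 2.
    have -> : (2 - r) * n ^+ 2 = n ^+ 2 - (r - 1) * n ^+ 2 by ring.
    move=> h; have : (1 + r) * ((r - 1) * n ^+ 2) <=
      (1 + r) * (n ^+ 2 - a ^+ 2 - b ^+ 2) by apply: ler_wpM2l; lra.
    have -> : (1 + r) * ((r - 1) * n ^+ 2) = (r * r - 1) * n ^+ 2 by ring.
    rewrite r2; lra.
  (* If [a <= n / 2], the sum is at most [n ^+ 2 / 2] and [r <= 3 / 2] suffices; otherwise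
     [b <= n - a] leaves a quadratic in [a]. *)
  have [an2|an2] := leP (2 * a) n.
    have : a ^+ 2 <= (n / 2) ^+ 2 by rewrite lerXn2r ?nnegrE; lra.
    have : b ^+ 2 <= a ^+ 2 by rewrite lerXn2r ?nnegrE; lra.
    have : 0 <= (3 / 2 - r) * n ^+ 2 by rewrite mulr_ge0 ?sqr_ge0; lra.
    lra.
  have : b ^+ 2 <= (n - a) ^+ 2 by rewrite lerXn2r ?nnegrE; lra.
  (* The roots of [2 a^2 - 2 n a + (r - 1) n^2] are [n / r] and [n - n / r]. *)
  have : 0 <= (n - r * a) * (r * a - (r - 1) * n) by apply: mulr_ge0; nra.
  have -> : (n - r * a) * (r * a - (r - 1) * n) =
    r * r * (a * n - a ^+ 2) - (r - 1) * n ^+ 2 by ring.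
  rewrite r2; lra.
move=> s0 t0 stn.
have [tn|tn] := leP n (r * t); first by apply: Or31; exact: large.
have [sn|sn] := leP n (r * s).
  apply: Or32; rewrite addrAC; apply: large => //; lra.
apply: Or33; have [ts|st] := leP t s; first by apply: small => //; lra.
by rewrite addrAC; apply: small; lra.
Qed.

(** Later [u], [u'] count the rows and [w], [w'] the columns with majority 1 and 0; the alternatives
    serve the constant 0, the constant 1 and the better of the two. AM-GM on the mixed areas gives
    [s + t <= n] for the square roots. *)
Lemma diagonal_rectangles (u u' w w' : R) :
  0 <= u -> 0 <= u' -> 0 <= w -> 0 <= w' ->
  [\/ u * w + u * w' + u' * w <= (1 + Num.sqrt 2) / 2 * (u * w' + u' * w),
      u' * w' + u * w' + u' * w <= (1 + Num.sqrt 2) / 2 * (u * w' + u' * w) |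
      (u + u') * (w + w') / 2 <= (1 + Num.sqrt 2) / 2 * (u * w' + u' * w)].
Proof.
move=> u0 u'0 w0 w'0.
have [s s0 s2] : exists2 s, 0 <= s & s ^+ 2 = u * w.
  by exists (Num.sqrt (u * w)); rewrite ?sqrtr_ge0 ?sqr_sqrtr ?mulr_ge0.
have [t t0 t2] : exists2 t, 0 <= t & t ^+ 2 = u' * w'.
  by exists (Num.sqrt (u' * w')); rewrite ?sqrtr_ge0 ?sqr_sqrtr ?mulr_ge0.
have [n n0 n2] : exists2 n, 0 <= n & n ^+ 2 = (u + u') * (w + w').
  exists (Num.sqrt ((u + u') * (w + w'))); rewrite ?sqrtr_ge0 //.
  by rewrite sqr_sqrtr // mulr_ge0 ?addr_ge0.
have uw'0 : 0 <= u * w' by rewrite mulr_ge0.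
have u'w0 : 0 <= u' * w by rewrite mulr_ge0.
have cauchy : 2 * (s * t) <= u * w' + u' * w.
  rewrite -(@ler_pXn2r _ 2) ?nnegrE ?addr_ge0 ?mulr_ge0 //.
  have -> : (2 * (s * t)) ^+ 2 = 4 * (s ^+ 2 * t ^+ 2) by ring.
  by rewrite s2 t2; have := sqr_ge0 (u * w' - u' * w); lra.
have stn : s + t <= n.
  by rewrite -(@ler_pXn2r _ 2) ?nnegrE ?addr_ge0 // sqrrD s2 t2 n2; lra.
have := diagonal_rectangles_sqrt s0 t0 stn; rewrite s2 t2 n2.
have -> : (u + u') * (w + w') - u * w - u' * w' = u * w' + u' * w by ring.
by case=> h; [apply: Or31 | apply: Or32 | apply: Or33];
  apply: le_trans h => //; lra.
Qed.

(** A cell where the majorities [g] and [h] disagree adds 1 to [D]; where they agree it adds 2 if it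
    deviates from the common value, else 0. Hence half of [D - (u * w' + u' * w)] counts the
    deviating cells. *)
Lemma L1_block_le (N M : nat) (X : 'M[R]_(N, M))
    (A : {set 'I_N}) (B : {set 'I_M}) :
  (forall i j, X i j = 0 \/ X i j = 1) ->
  dissim_L1 (submatrix X A B) <= (1 + Num.sqrt 2) / 2 *
    (\sum_(j in B) dissim_L1 (submatrix X A [set j]) +
     \sum_(i in A) dissim_L1 (submatrix X [set i] B)).
Proof.
move=> bin_X.
set V := dissim_L1 _; set cost := \sum_(j in B) _ + _.
pose g i : R := (majority (mem B) (X i))%:R.
pose h j : R := (majority (mem A) (X^~ j))%:R.
pose d i j := `|X i j - h j| + `|X i j - g i|.
pose D := \sum_(i in A) \sum_(j in B) d i j.
have D_cost : D <= cost.
  rewrite /D /cost; under eq_bigr do rewrite big_split.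
  rewrite big_split /= exchange_big; apply: lerD; apply: ler_sum => k _.
    have [c ->] := submatrix_attained minimal_loss_L1 X A [set k].
    under [leRHS]eq_bigr do rewrite big_set1.
    exact: (@majority_le _ (mem A) (X^~ k)).
  have [c ->] := submatrix_attained minimal_loss_L1 X [set k] B.
  by rewrite big_set1; apply: (@majority_le _ (mem B) (X k)).
pose u := \sum_(i in A) g i; pose u' := \sum_(i in A) (1 - g i).
pose w := \sum_(j in B) h j; pose w' := \sum_(j in B) (1 - h j).
have g01 i : g i = 0 \/ g i = 1 by rewrite /g; case: majority; [right|left].
have h01 j : h j = 0 \/ h j = 1 by rewrite /h; case: majority; [right|left].
have u0 : 0 <= u by apply: sumr_ge0 => i _; case: (g01 i) => ->; lra.
have u'0 : 0 <= u' by apply: sumr_ge0 => i _; case: (g01 i) => ->; lra.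
have w0 : 0 <= w by apply: sumr_ge0 => j _; case: (h01 j) => ->; lra.
have w'0 : 0 <= w' by apply: sumr_ge0 => j _; case: (h01 j) => ->; lra.
have rect (p : 'I_N -> R) (q : 'I_M -> R) :
    (\sum_(i in A) p i) * (\sum_(j in B) q j) =
    \sum_(i in A) \sum_(j in B) p i * q j.
  by rewrite big_distrlr.
have D_mixed : u * w' + u' * w <= D.
  rewrite !rect -big_split; apply: ler_sum => i _; rewrite -big_split.
  apply: ler_sum => j _ /=; rewrite /d.
  case: (bin_X i j) (g01 i) (h01 j) => -> [] -> [] ->;
    rewrite ?subrr ?subr0 ?sub0r ?normrN ?normr0 ?normr1; lra.
(* The constant 0 pays at most for the whole ones rectangle, both mixed ones and the deviating cells
   of the zeros rectangle. Doubling avoids halves in the cellwise check. *)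
have V_ones : V <= u * w + u * w' + u' * w + (D - (u * w' + u' * w)) / 2.
  apply: le_trans (submatrix_le minimal_loss_L1 X A B 0) _.
  suff : \sum_(i in A) \sum_(j in B) 2 * `|X i j - 0| <=
      2 * (u * w) + u * w' + u' * w + D.
    by under eq_bigr do rewrite -mulr_sumr; rewrite -mulr_sumr; lra.
  rewrite !rect mulr_sumr -!big_split; apply: ler_sum => i _ /=.
  rewrite mulr_sumr -!big_split; apply: ler_sum => j _ /=; rewrite /d.
  case: (bin_X i j) (g01 i) (h01 j) => -> [] -> [] ->;
    rewrite ?subrr ?subr0 ?sub0r ?normrN ?normr0 ?normr1; lra.
have V_zeros : V <= u' * w' + u * w' + u' * w + (D - (u * w' + u' * w)) / 2.
  apply: le_trans (submatrix_le minimal_loss_L1 X A B 1) _.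
  suff : \sum_(i in A) \sum_(j in B) 2 * `|X i j - 1| <=
      2 * (u' * w') + u * w' + u' * w + D.
    by under eq_bigr do rewrite -mulr_sumr; rewrite -mulr_sumr; lra.
  rewrite !rect mulr_sumr -!big_split; apply: ler_sum => i _ /=.
  rewrite mulr_sumr -!big_split; apply: ler_sum => j _ /=; rewrite /d.
  case: (bin_X i j) (g01 i) (h01 j) => -> [] -> [] ->;
    rewrite ?subrr ?subr0 ?sub0r ?normrN ?normr0 ?normr1; lra.
(* The costs of the constants 0 and 1 add up to the area. *)
have V_half : V <= (u + u') * (w + w') / 2.
  have V0 := submatrix_le minimal_loss_L1 X A B 0.
  have V1 := submatrix_le minimal_loss_L1 X A B 1.
  suff : \sum_(i in A) \sum_(j in B) `|X i j - 0| +
         \sum_(i in A) \sum_(j in B) `|X i j - 1| = (u + u') * (w + w').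
    by rewrite /V => ?; lra.
  rewrite /u /u' /w /w' -!big_split rect /=; apply: eq_bigr => i _.
  rewrite -big_split; apply: eq_bigr => j _ /=.
  by case: (bin_X i j) => ->;
    rewrite ?subrr ?subr0 ?sub0r ?normrN ?normr0 ?normr1; lra.
set k := (1 + Num.sqrt 2) / 2.
have k_half : 1 / 2 <= k by have := sqrtr_ge0 (2 : R); rewrite /k; lra.
apply: le_trans (_ : k * D <= _); last by apply: ler_wpM2l => //; lra.
(* Since [k >= 1 / 2], the deviating cells are paid for, and only the areas remain to be
   compared. *)
have excess : (D - (u * w' + u' * w)) / 2 <= k * (D - (u * w' + u' * w)).
  by rewrite mulrC; apply: ler_wpM2r; lra.
by case: (diagonal_rectangles u0 u'0 w0 w'0); rewrite -/k => ?; lra.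
Qed.

End LeastAbsolute.

Theorem theorem1 (R : realType) (N M Kr Kc : nat) (X : 'M[R]_(N, M))
    (hKr : (1 <= Kr <= N)%N) (hKc : (1 <= Kc <= M)%N) :
  ((forall (i : 'I_N) (j : 'I_M), X i j = 0 \/ X i j = 1) ->
   forall (P : {set {set 'I_N}}) (Q : {set {set 'I_M}}) (Lstar : R),
     optimal_rows (@dissim_L1 R) X Kr P ->
     optimal_cols (@dissim_L1 R) X Kc Q ->
     is_optimal_bicluster_cost (@dissim_L1 R) X Kr Kc Lstar ->
     bicluster_cost (@dissim_L1 R) X P Q <= (1 + Num.sqrt 2) * Lstar)
  /\
  (forall (P : {set {set 'I_N}}) (Q : {set {set 'I_M}}) (Lstar : R),
     optimal_rows (@dissim_L2 R) X Kr P ->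
     optimal_cols (@dissim_L2 R) X Kc Q ->
     is_optimal_bicluster_cost (@dissim_L2 R) X Kr Kc Lstar ->
     bicluster_cost (@dissim_L2 R) X P Q <= 2 * Lstar).
Proof.
split=> [bin_X|] P Q Lstar optP optQ optL.
  have -> : 1 + Num.sqrt 2 = 2 * ((1 + Num.sqrt 2) / 2) :> R by field.
  apply: (bicluster_ratio (@minimal_loss_L1 R) _ _ optP optQ optL).
    by have := sqrtr_ge0 (2 : R); lra.
  by move=> A B; exact: L1_block_le.
rewrite -[2]mulr1.
apply: (bicluster_ratio (@minimal_loss_L2 R) _ _ optP optQ optL) => // A B.
by rewrite mul1r; exact: L2_block_le.
Qed.
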